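(* Let $p$ be a prime and let $A$ be a brace whose additive group is isomorphic to $C_{p^{i_1}}\oplus\cdots\oplus C_{p^{i_\beta}}$ for some $\beta$ and some $i_1,\dots,i_\beta$, and let $\alpha$ be a natural number with $\alpha\le i_1,\dots,\alpha\le i_\beta$. Assume that $p^\alpha A$ is an ideal in $A$ (this happens for example when $A$ satisfies Property $1'$). Then the additive group of the brace $A/p^\alpha A$ is isomorphic to $C_{p^\alpha}^{\oplus\beta}=C_{p^\alpha}\oplus\cdots\oplus C_{p^\alpha}$. Consequently the additive group of $A/p^\alpha A$ is uniform.
   Context: A (left) brace is a set $A$ with operations $+,\circ$ such that $(A,+)$ is an abelian group, $(A,\circ)$ is a group and $a\circ(b+c)+a=a\circ b+a\circ c$ for all $a,b,c$. Put $a*b=a\circ b-a-b$. An ideal is an additive subgroup $I$ with $i*a,\,a*i\in I$ for all $i\in I,a\in A$; then $A/I$ is a brace. $C_{q}$ is the cyclic group of order $q$, and $p^\alpha A=\{p^\alpha a:a\in A\}$. Uniform means: a direct sum of cyclic groups all of the same order $p^\alpha$. Property $1'$ (for braces of order a power of a prime $p>2$): with $m=\lfloor (p-1)/4\rfloor$, for all $a,b\in A$, $a*(a*(\cdots*(a*b)\cdots))\in pA$ with $a$ appearing $m$ times, and $a*(a*(\cdots*(a*a)\cdots))\in pA$ with $a$ appearing $m$ times in total (for $m=0$ the first condition reads $b\in pA$ and the second is void). *)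

(* Defs.v *)
From HB Require Import structures.
From mathcomp Require Import all_boot all_order all_algebra.
From mathcomp Require Import boolp.

Set Implicit Arguments.
Unset Strict Implicit.
Unset Printing Implicit Defensive.

Import GRing.Theory.
Local Open Scope ring_scope.
Local Open Scope quotient_scope.

Declare Scope brace_scope.
Delimit Scope brace_scope with brace.
Local Open Scope brace_scope.

Reserved Notation "a ∘ b" (at level 40, left associativity).
Reserved Notation "a ⋆ b" (at level 40, left associativity).

(* Left braces: the additive group is the zmodType structure, the operation ∘ *)
(* is the multiplication of the groupType structure.                         *)
HB.mixin Record Zmodule_isLeftBrace A of GRing.Zmodule A & Group A := {
  brace_subproof : forall a b c : A,
    (a * (b + c)%R)%g + a = (a * b)%g + (a * c)%g
}.

#[short(type="leftBraceType")]
HB.structure Definition LeftBrace :=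
  {A of GRing.Zmodule A & Group A & Zmodule_isLeftBrace A}.

Notation "a ∘ b" := (a * b)%g : brace_scope.

Definition bstar (A : leftBraceType) (a b : A) : A := a ∘ b - a - b.

Notation "a ⋆ b" := (bstar a b) : brace_scope.

Definition is_brace_ideal (A : leftBraceType) (I : {pred A}) : Prop :=
  zmod_closed I /\
  forall i a : A, i \in I -> (i ⋆ a \in I) /\ (a ⋆ i \in I).

Section BraceTheory.
Variable A : leftBraceType.
Implicit Types a b c : A.

Lemma braceD a b c : a ∘ (b + c) = a ∘ b - a + a ∘ c.
Proof. by rewrite addrAC -brace_subproof addrK. Qed.

Lemma brace_one0 : 1%g = 0 :> A.
Proof.
by have /esym := brace_subproof 1%g 0 0 :> (_ = _ :> A); rewrite !mul1g !add0r.
Qed.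

Lemma bstarE a b : a ∘ b = a ⋆ b + a + b.
Proof. by rewrite /bstar addrAC subrK subrK. Qed.

End BraceTheory.

Section BraceQuotient.
Variables (A : leftBraceType) (I : {pred A}) (hI : is_brace_ideal I).

Definition ideal_zmod : zmodClosed A :=
  HB.pack (I : A -> bool) (GRing.isZmodClosed.Build A I (proj1 hI)).

(* A / I, with the additive structure of Quotient.quot. *)
Definition brace_quot : Type := Quotient.quot ideal_zmod.

HB.instance Definition _ := GRing.Zmodule.on brace_quot.
HB.instance Definition _ := EqQuotient.on brace_quot.

Local Notation Q := brace_quot.
Local Notation J := (ideal_zmod : {pred A}).

Lemma brace_quotP (x y : A) : reflect (x = y %[mod Q]) (x - y \in J).
Proof. by rewrite Quotient.idealrBE; apply: eqP. Qed.

Lemma circ_idealr (x y i : A) : i \in J -> x ∘ (y + i) - x ∘ y \in J.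
Proof.
move=> Ji; rewrite braceD [x ∘ i]bstarE.
have E (u v s t : A) : u - v + (s + v + t) - u = s + t.
  by rewrite [s + v]addrC -(addrA v) (addrA (u - v)) subrK [u + _]addrC addrK.
by rewrite E rpredD //; exact: (proj2 ((proj2 hI) i x Ji)).
Qed.

Lemma circ_ideall (x y i : A) : i \in J -> (x + i) ∘ y - x ∘ y \in J.
Proof.
move=> Ji; pose j := x^-1%g ⋆ i + i.
have Jj : j \in J by rewrite rpredD //; exact: (proj2 ((proj2 hI) i _ Ji)).
have -> : x + i = x ∘ j.
  have -> : j = x^-1%g ∘ i - x^-1%g by rewrite bstarE addrAC addrK.
  have := brace_subproof x (x^-1%g ∘ i - x^-1%g) x^-1%g.
  by rewrite subrK mulgA mulgV mul1g brace_one0 addr0 addrC.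
rewrite -mulgA (bstarE j y) addrC [_ + y]addrC addrC.
by apply: circ_idealr; rewrite rpredD //; exact: (proj1 ((proj2 hI) j y Jj)).
Qed.

Lemma brace_quot_circ (x x' y y' : A) :
  x = x' %[mod Q] -> y = y' %[mod Q] -> x ∘ y = x' ∘ y' %[mod Q].
Proof.
move=> /brace_quotP Jx /brace_quotP Jy; apply/brace_quotP.
have -> : x ∘ y - x' ∘ y' = (x ∘ y - x' ∘ y) + (x' ∘ y - x' ∘ y').
  by rewrite addrA subrK.
rewrite rpredD //.
  by have := circ_ideall x' y Jx; rewrite [x' + _]addrC subrK.
by have := circ_idealr x' y' Jy; rewrite [y' + _]addrC subrK.
Qed.

Definition quot_circ (u v : Q) : Q := \pi_Q (repr u ∘ repr v).
Definition quot_one : Q := \pi_Q 1%g.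
Definition quot_inv (u : Q) : Q := \pi_Q (repr u)^-1%g.

Lemma pi_circ (x y : A) : quot_circ (\pi_Q x) (\pi_Q y) = \pi_Q (x ∘ y).
Proof. by apply: brace_quot_circ; rewrite reprK. Qed.

Lemma pi_surj (u : Q) : exists x, u = \pi_Q x.
Proof. by exists (repr u); rewrite reprK. Qed.

Lemma quot_circA : associative quot_circ.
Proof.
move=> u v w; have [x ->] := pi_surj u; have [y ->] := pi_surj v.
have [z ->] := pi_surj w.
by rewrite (pi_circ y z) (pi_circ x y) (pi_circ x (y ∘ z)) (pi_circ (x ∘ y) z)
           mulgA.
Qed.

Lemma quot_circ1 : left_id quot_one quot_circ.
Proof. by move=> u; have [x ->] := pi_surj u; rewrite pi_circ mul1g. Qed.

Lemma quot_1circ : right_id quot_one quot_circ.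
Proof. by move=> u; have [x ->] := pi_surj u; rewrite pi_circ mulg1. Qed.

Lemma quot_circV : left_inverse quot_one quot_inv quot_circ.
Proof. by move=> u; rewrite -[u in quot_circ _ u]reprK pi_circ mulVg. Qed.

Lemma quot_circrV : right_inverse quot_one quot_inv quot_circ.
Proof. by move=> u; rewrite -[u in quot_circ u _]reprK pi_circ mulgV. Qed.

HB.instance Definition _ :=
  isGroup.Build Q quot_circA quot_circ1 quot_1circ quot_circV quot_circrV.

Lemma pi_circ_mul (x y : A) : (\pi_Q x * \pi_Q y)%g = \pi_Q (x ∘ y).
Proof. exact: pi_circ. Qed.

Lemma quot_brace (a b c : Q) :
  (a * (b + c)%R)%g + a = (a * b)%g + (a * c)%g.
Proof.
have [x ->] := pi_surj a; have [y ->] := pi_surj b; have [z ->] := pi_surj c.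
have D (s t : A) : \pi_Q s + \pi_Q t = \pi_Q (s + t).
  exact: esym (raddfD (\pi_(Quotient.quot ideal_zmod)) s t).
by rewrite (D y z) !pi_circ_mul !D brace_subproof.
Qed.

HB.instance Definition _ := Zmodule_isLeftBrace.Build Q quot_brace.

End BraceQuotient.

Section DirectSum.
Variables (I : finType) (V : I -> zmodType).

(* External direct sum of a finite family of abelian groups; the library only *)
(* provides a zmodType structure when the family is constant.                 *)
Definition dsum : Type := {dffun forall i, V i}.

HB.instance Definition _ := Choice.on dsum.

Definition dsum_zero : dsum := [ffun i => 0 : V i].
Definition dsum_opp (f : dsum) : dsum := [ffun i => - f i : V i].
Definition dsum_add (f g : dsum) : dsum := [ffun i => f i + g i : V i].

Lemma dsum_addA : associative dsum_add.
Proof. by move=> f g h; apply/ffunP=> i; rewrite !ffunE addrA. Qed.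

Lemma dsum_addC : commutative dsum_add.
Proof. by move=> f g; apply/ffunP=> i; rewrite !ffunE addrC. Qed.

Lemma dsum_add0 : left_id dsum_zero dsum_add.
Proof. by move=> f; apply/ffunP=> i; rewrite !ffunE add0r. Qed.

Lemma dsum_addN : left_inverse dsum_zero dsum_opp dsum_add.
Proof. by move=> f; apply/ffunP=> i; rewrite !ffunE addNr. Qed.

HB.instance Definition _ :=
  GRing.isZmodule.Build dsum dsum_addA dsum_addC dsum_add0 dsum_addN.

End DirectSum.

(* Cyclic group of order q, for q > 0. Unlike 'Z_q, it is trivial for q = 1. *)
Definition Cyc (q : nat) : zmodType := 'I_q.-1.+1.

Definition zmod_isog (U V : zmodType) : Prop :=
  exists f : {additive U -> V}, bijective f.

Definition uniform (p : nat) (U : zmodType) : Prop :=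
  exists alpha n : nat, zmod_isog U (dsum (fun _ : 'I_n => Cyc (p ^ alpha))).

(* n A = {n a : a in A}. *)
Definition multiples (A : zmodType) (n : nat) : {pred A} :=
  fun x => `[< exists a : A, x = a *+ n >].

Arguments multiples : clear implicits.

(* For m = 0 the first condition reads b \in p A and the second is void. In   *)
(* the second one a occurs m times in total, the innermost one included.      *)
Definition property1' (p : nat) (A : leftBraceType) : Prop :=
  let m := (p.-1 %/ 4)%N in
  (forall a b : A, iter m (bstar a) b \in multiples A p) /\
  ((0 < m)%N -> forall a : A, iter m.-1 (bstar a) a \in multiples A p).

(* Main.v *)
Require Import Defs.
From HB Require Import structures.
From mathcomp Require Import all_boot all_order all_algebra.
From mathcomp Require Import all_fingroup pgroup sylow boolp.

Set Implicit Arguments.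
Unset Strict Implicit.
Unset Printing Implicit Defensive.

Import GRing.Theory.
Local Open Scope ring_scope.
Local Open Scope brace_scope.

(** The quotient statement is a first isomorphism theorem: reducing each
coordinate modulo p^alpha maps (+)_j C_{p^{i_j}} onto C_{p^alpha}^beta, and,
since alpha <= i_j for all j, its kernel is exactly the set of multiples of
p^alpha (dsum_red_surj, dsum_red_eq0, brace_quot_isog).

The substance is that Property 1' makes p^k A an ideal. Let m be the
number of factors in Property 1'. If m = 0 then A = pA = p^k A, so let m > 0. The maps
L_a = (b |-> a ⋆ b) are additive, so only (p^k x) ⋆ b in p^k A has to be proved.
Let S be the set of x with x ⋆ b in p^k A for all b; it is closed under ∘.
Writing a^n for the n-th ∘-power of a, one has the binomial formulas
  a^n ⋆ b = sum_{1 <= j <= n} binom(n, j) L_a^j b,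
  a^n = sum_{1 <= j <= n} binom(n, j) L_a^{j-1} a.
For n = p^e, the binomial coefficient is divisible by p^{e-v}, where v is the
p-adic valuation of j. As 4m < p, Property 1' puts L_a^j b in p^v A, and even
L_a^{j-1} a in p^{v+1} A when v > 0. Two consequences follow.
- The power a^{p^e} lies in S as soon as e >= k (expg_bstar).
- If I is a left ideal containing pA and b ⋆ a lies in I for all b, then
  a^{p^e} = p^e (a + z) for some z in I (expg_approx).
Let Z_0 = pA and Z_{t+1} = {a : b ⋆ a in Z_t for all b}. The p-group (A, ∘) acts
on the p-group A / Z_t through b |-> L_a b + b and therefore has a nonzero fixed
point there unless Z_t = A; hence Z_t = A for large t (left_series_full).
Finally p^n A is contained in S for all n >= k, by descending induction on n, and
for fixed n by induction on t along the Z_t: an element p^n a with a in Z_{t+1}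
is a^{p^n} + p^n (- z) with z in Z_t, which is the ∘-product of a^{p^n} with some
p^n z', z' in Z_t, and both factors belong to S (multiples_bstar). *)

(** * The star operation and powers in a left brace *)

Section Star.
Variable A : leftBraceType.
Implicit Types a b c x y : A.

Lemma bstarD a b c : a ⋆ (b + c) = a ⋆ b + a ⋆ c.
Proof.
by rewrite /bstar braceD opprD (AC (4*2) ((1*2*5)*(3*4*6))).
Qed.

Lemma bstarB a : zmod_morphism (bstar a).
Proof.
move=> b c; apply/eqP; rewrite eq_sym subr_eq -bstarD.
by rewrite subrK.
Qed.

HB.instance Definition _ a := GRing.isZmodMorphism.Build A A (bstar a) (bstarB a).

Lemma bstarMn a n : {morph bstar a : b / b *+ n}.
Proof. exact: raddfMn. Qed.

Lemma bstarN a : {morph bstar a : b / - b}.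
Proof. exact: raddfN. Qed.

Lemma bstar0 a : a ⋆ 0 = 0.
Proof. exact: raddf0. Qed.

Lemma iter_bstarMn a b n j :
  iter j (bstar a) (b *+ n) = iter j (bstar a) b *+ n.
Proof. by elim: j => //= j ->; rewrite bstarMn. Qed.

Lemma circ_starE a b : a ∘ b = a ⋆ b + b + a.
Proof. by rewrite bstarE addrAC. Qed.

Lemma bstarM a b c : (a ∘ b) ⋆ c = a ⋆ (b ⋆ c) + a ⋆ c + b ⋆ c.
Proof.
have := mulgA a b c; rewrite (circ_starE (a ∘ b) c) (circ_starE a (b ∘ c)).
rewrite (circ_starE b c) (circ_starE a b) !bstarD.
move=> /esym E; apply: (addIr (c + (a ⋆ b + b + a))); rewrite [LHS]addrA E.
by rewrite (AC ((3*3)*1) (((1*2)*4)*(5*(3*6*7))))/=.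
Qed.

Lemma bstar1l b : 1%g ⋆ b = 0.
Proof. by rewrite /bstar mul1g brace_one0 subr0 subrr. Qed.

(** An addition is a circle product whose right factor lies in every left ideal
that contains y. *)
Lemma addr_circ x y : x + y = x ∘ (x^-1%g ⋆ y + y).
Proof.
by rewrite circ_starE bstarD addrA -bstarM mulgV bstar1l add0r addrC.
Qed.

Lemma bstar_expg a n b :
  (a ^+ n)%g ⋆ b + b = \sum_(j < n.+1) iter j (bstar a) b *+ 'C(n, j).
Proof.
elim: n => [|n IH].
  by rewrite big_ord1 /= expg0 bstar1l add0r bin0.
have -> : (a ^+ n.+1)%g ⋆ b + b
    = a ⋆ ((a ^+ n)%g ⋆ b + b) + ((a ^+ n)%g ⋆ b + b).
  by rewrite expgS bstarM bstarD !addrA.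
rewrite {}IH raddf_sum /=.
have -> : \sum_(j < n.+1) iter j (bstar a) b *+ 'C(n, j)
    = b + \sum_(j < n.+1) iter j.+1 (bstar a) b *+ 'C(n, j.+1).
  transitivity (\sum_(j < n.+2) iter j (bstar a) b *+ 'C(n, j)).
    by rewrite [RHS]big_ord_recr /= bin_small // addr0.
  by rewrite big_ord_recl bin0.
rewrite addrCA [RHS]big_ord_recl bin0 -big_split; congr (_ + _).
by apply: eq_bigr => j _; rewrite bstarMn binS addnC mulrnDr.
Qed.

Lemma expg_sum a n :
  (a ^+ n)%g = \sum_(j < n) iter j (bstar a) a *+ 'C(n, j.+1).
Proof.
elim: n => [|n IH]; first by rewrite big_ord0 expg0 brace_one0.
rewrite expgSr circ_starE bstar_expg {}IH [RHS]big_ord_recr /=.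
rewrite big_ord_recr /= binn addrAC -big_split /= binn; congr (_ + _).
by apply: eq_bigr => j _; rewrite binS addnC mulrnDr.
Qed.

(** * Left ideals and the ascending left series *)

(** A left ideal of a left brace: an additive subgroup stable under all the
maps b |-> a ⋆ b. *)
Definition left_ideal (I : {pred A}) : Prop :=
  zmod_closed I /\ forall a x, x \in I -> a ⋆ x \in I.

Lemma iter_bstar_left_ideal (I : {pred A}) a j x : left_ideal I ->
  x \in I -> iter j (bstar a) x \in I.
Proof. by move=> [_ st] Ix; elim: j => //= j; apply: st. Qed.

(** The ascending series starting at I whose (t+1)-st term consists of the x such
that a ⋆ x is in the t-th term for all a; modulo I, these are the iterated
fixed points of the action of (A, ∘) on A by the maps x |-> a ⋆ x + x. *)
Fixpoint left_series (I : {pred A}) (t : nat) : {pred A} :=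
  if t is t'.+1 then fun x => `[< forall a, a ⋆ x \in left_series I t' >]
  else I.

Lemma left_seriesS I t x :
  reflect (forall a, a ⋆ x \in left_series I t) (x \in left_series I t.+1).
Proof. exact: asboolP. Qed.

Lemma left_series_ideal I t : left_ideal I -> left_ideal (left_series I t).
Proof.
move=> lI; elim: t => [//|t [[J0 JB] Jst]]; split; first split.
- by apply/left_seriesS => a; rewrite bstar0.
- move=> x y /left_seriesS Jx /left_seriesS Jy.
  by apply/left_seriesS => a; rewrite bstarD bstarN JB.
- move=> a x /left_seriesS Jx; apply/left_seriesS => b.
  exact: Jst (Jx a).
Qed.

Lemma left_series_sub I t x : left_ideal I ->
  x \in left_series I t -> x \in left_series I t.+1.
Proof.
move=> lI Jx; apply/left_seriesS => a.
by have [_] := left_series_ideal t lI; apply.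
Qed.

Lemma multiplesP n x : reflect (exists a, x = a *+ n) (x \in multiples A n).
Proof. exact: asboolP. Qed.

Lemma mem_multiples n x : x *+ n \in multiples A n.
Proof. by apply/multiplesP; exists x. Qed.

Lemma multiplesW k l x : (k %| l)%N -> x \in multiples A l ->
  x \in multiples A k.
Proof.
move=> /dvdnP[c ->] /multiplesP[y ->].
by rewrite mulrnA mem_multiples.
Qed.

Lemma multiples_left_ideal n : left_ideal (multiples A n).
Proof.
split; first split.
- by apply/multiplesP; exists 0; rewrite mul0rn.
- move=> x y /multiplesP[a ->] /multiplesP[b ->].
  by rewrite -mulrnBl mem_multiples.
- by move=> a x /multiplesP[b ->]; rewrite bstarMn mem_multiples.
Qed.

End Star.

(** * Fixed points of p-groups *)

(** A p-group acting by automorphisms on a finite abelian p-group V and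
preserving a proper subgroup M0 has a nonzero fixed point in V / M0. The
quotient is represented by the set of cosets of M0, on which the number of fixed
points is congruent to the index of M0, that is to 0, modulo p. *)
Lemma pgroup_fix_coset (p : nat) (gT : finGroupType) (V : finZmodType)
    (act : gT -> V -> V) (M0 : {set V}) :
    prime p -> (p.-group [set: gT])%g -> (p.-group [set: V])%g ->
    (forall v, act 1%g v = v) ->
    (forall g h v, act (g * h)%g v = act g (act h v)) ->
    (forall g, {morph act g : u v / u + v}) ->
    zmod_closed M0 ->
    (forall g v, v \in M0 -> act g v \in M0) ->
    M0 != [set: V] ->
  exists2 v, v \notin M0 & forall g, act g v - v \in M0.
Proof.
move=> p_pr pG pV act1 actM actD [M00 M0B] M0st M0nT.
have gM : group_set M0.
  apply/group_setP; split=> // u v M0u M0v.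
  by rewrite FinRing.zmodMgE -[v]opprK M0B // -sub0r M0B.
pose M : {group V} := Group gM.
have Mst g v : v \in M -> act g v \in M by apply: M0st.
have MnT : M != [set: V] :> {set V} by [].
suff [v Mv stv] : exists2 v, v \notin M & forall g, act g v - v \in M by exists v.
(* Actions are on the right, hence the inverse. *)
pose to g v := act v^-1%g g.
have to1 x : to x 1%g = x by rewrite /to invg1 act1.
have toM x g h : to x (g * h)%g = to (to x g) h by rewrite /to invMg actM.
pose T := TotalAction to1 toM.
pose S := rcosets M [set: V].
have imM g : (T^* )%act M g = M :> {set V}.
  apply/eqP; rewrite eqEcard card_setact leqnn andbT.
  by apply/subsetP=> _ /imsetP[v Mv ->]; apply: Mst.
have imC g v : (T^* )%act (M :* v)%g g = (M :* act g^-1 v)%g.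
  apply/setP=> w; rewrite -{2}(imM g) /= /setact; apply/idP/idP.
    move=> /imsetP[_ /rcosetP[u Mu ->] ->]; apply/rcosetP.
    by exists (to u g); [apply: imset_f | exact: actD].
  move=> /rcosetP[_ /imsetP[u Mu ->] ->]; apply/imsetP.
  by exists (u + v); [apply/rcosetP; exists u | rewrite /= /to actD].
have actsS : [acts [set: gT], on S | T^* ]%g.
  apply/subsetP=> g _; rewrite !inE /=; apply/subsetP=> _ /rcosetsP[v _ ->].
  by rewrite inE imC; apply/rcosetsP; exists (act g^-1%g v).
have := pgroup_fix_mod pG actsS.
have pS : (p %| #|S|)%N.
  have /p_natP[n En] : (p.-nat #|S|)%N.
    by apply: pnat_dvd pV; apply: (dvdn_indexg [set: V]%G M).
  have: #|S| != 1%N.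
    by rewrite (indexg_eq1 [set: V]%G M) subTset.
  by rewrite En; case: n {En} => // n _; rewrite expnS dvdn_mulr.
rewrite (eqP pS) => /esym/eqP pF.
have MF : (M : {set V}) \in 'Fix_(S | T^* )([set: gT])%g.
  rewrite inE; apply/andP; split.
    by apply/rcosetsP; exists 1%g; rewrite ?rcoset1.
  by apply/afixP => g _; exact: imM.
have [C CF CM] : exists2 C, C \in 'Fix_(S | T^* )([set: gT])%g & C != M.
  apply/exists_inP; apply: contraLR pF => /exists_inPn noC.
  suff -> : 'Fix_(S | T^* )([set: gT])%g = [set (M : {set V})].
    by rewrite cards1 modn_small ?prime_gt1.
  apply/eqP; rewrite eqEsubset sub1set MF andbT.
  by apply/subsetP=> C /noC; rewrite inE negbK.
move: CF; rewrite inE => /andP[/rcosetsP[v _ EC] /afixP fixC].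
exists v => [|g]; first by apply: contra CM => Mv; rewrite EC rcoset_id.
have := fixC g^-1%g (in_setT _); rewrite EC imC invgK => E.
by have: act g v \in (M :* v)%g; [rewrite -E rcoset_refl | rewrite mem_rcoset].
Qed.

Section FiniteBrace.
Variables (p : nat) (A : leftBraceType) (F : finType) (f : A -> F) (g : F -> A).
Hypotheses (p_pr : prime p) (fK : cancel f g) (gK : cancel g f).
Hypothesis pF : (p.-nat #|F|)%N.

(** Some element outside a proper left ideal I is fixed modulo I by (A, ∘). *)
Lemma left_ideal_fix (I : {pred A}) : left_ideal I ->
  (exists x, x \notin I) -> exists2 x, x \notin I & forall a, a ⋆ x \in I.
Proof.
move=> [Iz Ist] [x0 Ix0].
(* The bijection with F makes A a finite type in two ways: as the group
   (A, ∘), which is gT, and as the abelian group (A, +), which is V. *)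
have pickleA : pcancel (pickle \o f) (fun n => omap g (unpickle n)).
  by move=> x /=; rewrite pickleK /= fK.
pose cA := Choice_isCountable.Build A pickleA.
pose cT : countType := HB.pack (A : Type) (Choice.class A) cA.
pose fA :=
   isFinite.Build cT (@pcan_enumP cT F f _ (can_pcan fK)).
pose gT : finGroupType := HB.pack (A : Type) (Group.class A) cA fA.
pose V : finZmodType := HB.pack (A : Type) (GRing.Zmodule.class A) cA fA.
have cardA (T : finType) (h : T -> F) (k : F -> T) : cancel h k -> cancel k h ->
   (p.-nat #|[set: T]|)%N.
  by move=> hK kK; rewrite cardsT (bij_eq_card (Bijective hK kK)).
pose M : {set V} := [set x : V | (x : A) \in I].
have inM x : (x \in M) = ((x : A) \in I) by rewrite inE.
have zM : zmod_closed M.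
  by split=> [|x y]; rewrite !inM; [exact: Iz.1 | exact: Iz.2].
have ID (x y : A) : x \in I -> y \in I -> x + y \in I.
  by move=> Ix Iy; rewrite -[y]opprK Iz.2 // -sub0r Iz.2 // Iz.1.
have [v|a b v|a v w|a v||x Mx stx] := @pgroup_fix_coset p gT V
    (fun a x => (a : A) ⋆ (x : A) + (x : A)) M p_pr
    (cardA gT _ _ fK gK) (cardA V _ _ fK gK) _ _ _ zM.
- by rewrite [X in X + _](bstar1l (v : A)) [LHS]add0r.
- transitivity (((a : A) ∘ (b : A)) ⋆ (v : A) + (v : A)) => //.
  by rewrite bstarM bstarD !addrA.
- transitivity ((a : A) ⋆ ((v : A) + (w : A)) + ((v : A) + (w : A))) => //.
  by rewrite bstarD addrACA.
- by rewrite !inM => Iv; apply: ID => //; apply: Ist.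
- by apply: contraNneq Ix0 => MT; rewrite -(inM (x0 : V)) MT in_setT.
exists (x : A) => [|a]; first by rewrite -(inM x).
by have := stx (a : A); rewrite inM; congr (_ \in I); apply: addrK.
Qed.

Lemma left_series_full (I : {pred A}) : left_ideal I ->
  exists t, forall x, x \in left_series I t.
Proof.
(* The series is strictly increasing until it is full. *)
move=> lI; pose Z t := [set y : F | g y \in left_series I t].
have H t : (forall x, x \in left_series I t) \/ (t <= #|Z t|)%N.
  elim: t => [|t [IH|IH]]; [by right | left => x | ].
    exact: left_series_sub.
  have [full|nfull] := pselect (forall x, x \in left_series I t).
    by left => x; apply: left_series_sub.
  right; apply: leq_ltn_trans IH _; apply: proper_card.
  have [|x Jx stx] := left_ideal_fix (left_series_ideal t lI).
    by apply/not_existsP => H; apply: nfull => x; apply: contra_notT (H x).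
  apply/properP; split.
    by apply/subsetP=> y; rewrite !inE; apply: left_series_sub.
  by exists (f x); rewrite !inE fK //; apply/left_seriesS.
have [] := H #|F|.+1; first by exists #|F|.+1.
by rewrite leqNgt ltnS max_card.
Qed.

End FiniteBrace.

(** * Powers of exponent p^n under Property 1' *)

Lemma dvdn_bin_ppow p n j : prime p -> (0 < j)%N ->
  (p ^ (n - logn p j) %| 'C(p ^ n, j))%N.
Proof.
move=> p_pr j0; have [->|C0] := posnP 'C(p ^ n, j); first exact: dvdn0.
rewrite pfactor_dvdn // leq_subLR -lognM // -pfactor_dvdn ?muln_gt0 ?j0 //.
by case: j j0 C0 => // j _ _; rewrite -mul_bin_diag dvdn_mulr.
Qed.

(** This is where the bound on m enters: with v = logn p j > 0 one has
(v+1) m <= 2 v m <= v p <= p^v <= j. *)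
Lemma logn_leq_div p m j : prime p -> (0 < m)%N -> (4 * m < p)%N ->
  (0 < logn p j)%N -> (logn p j < j %/ m)%N.
Proof.
move=> p_pr m0 mp v0.
have j0 : (0 < j)%N by case: j v0 => //; rewrite logn0.
move: v0; set v := logn p j => v0.
rewrite leq_divRL //; apply: leq_trans (dvdn_leq j0 (pfactor_dvdnn p j)).
rewrite -/v; case: v v0 => // v _; rewrite expnS.
have lv : (v < p ^ v)%N by rewrite ltn_expl ?prime_gt1.
have le2 : (v.+2 <= v.+1 * 2)%N by rewrite muln2 -addnn !addSn !addnS !ltnS leq_addl.
apply: leq_trans (_ : (4 * m) * p ^ v <= _)%N; last by rewrite leq_mul2r (ltnW mp) orbT.
rewrite (mulnC 4) -mulnA mulnC leq_mul2l; apply/orP; right.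
apply: leq_trans le2 _; rewrite mulnC; exact: leq_mul.
Qed.

(** Property 1' with an arbitrary exponent m such that 0 < 4 m < p. *)
Section Property1.
Variables (p m : nat) (A : leftBraceType).
Hypotheses (p_pr : prime p) (m0 : (0 < m)%N) (mp : (4 * m < p)%N).
Hypothesis star_m : forall a b : A, iter m (bstar a) b \in multiples A p.
Hypothesis star_self : forall a : A, iter m.-1 (bstar a) a \in multiples A p.
Implicit Types a b x : A.

Lemma iter_bstar_div a b t j : (t * m <= j)%N ->
  iter j (bstar a) b \in multiples A (p ^ t).
Proof.
move=> /subnK <-; rewrite iterD.
apply: iter_bstar_left_ideal (multiples_left_ideal _ _) _.
elim: t => [|t IH]; first by rewrite -[_ b]mulr1n mem_multiples.
have /multiplesP[c Ec] := IH.
rewrite mulSn iterD Ec iter_bstarMn.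
have /multiplesP[d ->] := star_m a c.
by rewrite -mulrnA -expnS mem_multiples.
Qed.

Lemma iter_bstar_self_div a t j : (t.+1 * m <= j.+1)%N ->
  iter j (bstar a) a \in multiples A (p ^ t.+1).
Proof.
move=> le_j; have -> : j = ((j - (t * m + m.-1)) + t * m + m.-1)%N.
  rewrite -addnA subnK // -ltnS -addnS prednK //.
  by rewrite addnC -mulSn.
rewrite iterD.
have /multiplesP[c ->] := star_self a.
rewrite iter_bstarMn.
have /multiplesP[d ->] := @iter_bstar_div a c t _ (leq_addl (j - (t * m + m.-1)) (t * m)).
by rewrite -mulrnA -expnSr mem_multiples.
Qed.

Lemma expg_bstar n a b : (a ^+ (p ^ n))%g ⋆ b \in multiples A (p ^ n).
Proof.
have [[M0 MB] _] := multiples_left_ideal A (p ^ n).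
pose I : zmodClosed A := HB.pack (multiples A (p ^ n) : A -> bool)
   (GRing.isZmodClosed.Build A _ (conj M0 MB)).
have -> : (a ^+ (p ^ n))%g ⋆ b =
    \sum_(j < p ^ n) iter j.+1 (bstar a) b *+ 'C(p ^ n, j.+1).
  apply: (addIr b); rewrite bstar_expg big_ord_recl bin0 addrC.
  by congr (_ + _); apply: eq_bigr.
apply: (@rpred_sum _ I) => j _; rewrite -[_ \in _]/(_ \in multiples A (p ^ n)).
set v := logn p j.+1.
have /(iter_bstar_div a b)/multiplesP[c ->] : (v * m <= j.+1)%N.
  rewrite -leq_divRL // /v; have [->//|v0] := posnP (logn p j.+1).
  exact: ltnW (logn_leq_div p_pr m0 mp v0).
rewrite -mulrnA.
apply: (@multiplesW A _ (p ^ v * 'C(p ^ n, j.+1))); last exact: mem_multiples.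
have := dvdn_bin_ppow n p_pr (ltn0Sn j); rewrite -/v => dvC.
apply: dvdn_trans (dvdn_mul (dvdnn _) dvC).
by rewrite -expnD dvdn_exp2l // -leq_subLR.
Qed.

(** In the expansion of a^{p^n}, the term j = 1 is p^n a. For j > 1, the term is
in p^n I when p does not divide j, because L_a^{j-1} a is in I; when p divides j
it is in p^{n+1} A, because of iter_bstar_self_div. *)
Lemma expg_approx (I : {pred A}) n a : left_ideal I ->
  {subset multiples A p <= I} -> (forall b, b ⋆ a \in I) ->
  exists2 z, z \in I & (a ^+ (p ^ n))%g = (a + z) *+ p ^ n.
Proof.
move=> [Iz Ist] pI sta.
pose J : zmodClosed A := HB.pack (I : A -> bool) (GRing.isZmodClosed.Build A _ Iz).
have pn0 : (0 < p ^ n)%N by rewrite expn_gt0 prime_gt0.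
have term j : exists2 z, z \in J &
    iter j.+1 (bstar a) a *+ 'C(p ^ n, j.+2) = z *+ p ^ n.
  set v := logn p j.+2.
  have dvC := dvdn_bin_ppow n p_pr (ltn0Sn j.+1).
  have [v0|v0] := posnP v.
    move: dvC; rewrite -/v v0 subn0 => /dvdnP[c ->].
    exists (iter j.+1 (bstar a) a *+ c); last by rewrite mulrnA.
    rewrite rpredMn // [_ \in _]/(_ \in I) iterSr.
    by apply: (@iter_bstar_left_ideal A I) (sta a); split.
  have lev := logn_leq_div p_pr m0 mp v0; rewrite -/v leq_divRL // in lev.
  have /multiplesP[c ->] := iter_bstar_self_div a lev.
  have /dvdnP[d Ed] : (p * p ^ n %| p ^ v.+1 * 'C(p ^ n, j.+2))%N.
    apply: dvdn_trans (dvdn_mul (dvdnn _) dvC).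
    by rewrite -expnS -expnD dvdn_exp2l // -/v addSn ltnS -leq_subLR.
  exists (c *+ d *+ p); last by rewrite -!mulrnA Ed mulnA.
  by apply: pI; apply: mem_multiples.
have [z Jz Ez] : exists2 z, z \in J &
   \sum_(j < (p ^ n).-1) iter j.+1 (bstar a) a *+ 'C(p ^ n, j.+2) = z *+ p ^ n.
  elim: (p ^ n).-1 => [|k [z Jz Ez]].
    by exists 0; rewrite ?rpred0 // big_ord0 mul0rn.
  have [y Jy Ey] := term k; exists (z + y); first exact: rpredD.
  by rewrite big_ord_recr /= Ez Ey mulrnDl.
exists z => //.
transitivity (\sum_(j < (p ^ n).-1.+1) iter j (bstar a) a *+ 'C(p ^ n, j.+1)).
  by rewrite expg_sum prednK.
by rewrite big_ord_recl /= bin1 mulrnDl -Ez.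
Qed.

(** The descending induction on n starts because p^N kills A, and each of its
steps is an induction along the left series of pA, which reaches A. *)
Lemma multiples_bstar n k a b N :
  (forall x : A, x *+ p ^ N = 0) ->
  (exists t, forall x, x \in left_series (multiples A p) t) ->
  (k <= n)%N -> (a *+ p ^ n) ⋆ b \in multiples A (p ^ k).
Proof.
move=> AN [t0 full].
have [[M0 MB] _] := multiples_left_ideal A (p ^ k).
pose I : zmodClosed A := HB.pack (multiples A (p ^ k) : A -> bool)
   (GRing.isZmodClosed.Build A _ (conj M0 MB)).
pose S x := forall b, x ⋆ b \in I.
have SM x y : S x -> S y -> S (x ∘ y).
  by move=> Sx Sy c; rewrite bstarM; apply: rpredD (rpredD (Sx _) (Sx _)) (Sy _).
(* Induction on d: n decreases from n >= N, where p^n A = 0. *)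
move: a b; have [d] : {d | N <= n + d}%N by exists N; rewrite leq_addl.
elim: d n => [|d IH] n led a b lekn.
  have -> : a *+ p ^ n = 0.
    by rewrite addn0 in led; rewrite -(subnK led) expnD mulnC mulrnA AN mul0rn.
  by rewrite -brace_one0 bstar1l.
have Sp x : x \in multiples A p -> S (x *+ p ^ n).
  move=> /multiplesP[y ->] c; rewrite -mulrnA -expnS; apply: IH.
    by rewrite addSnnS.
  exact: leqW.
suff main t x : x \in left_series (multiples A p) t -> S (x *+ p ^ n).
  exact: main (full a) b.
elim: t x => [|t IHt] x; first exact: Sp.
move=> /left_seriesS stx.
have lt := left_series_ideal t (multiples_left_ideal A p).
have pt : {subset multiples A p <= left_series (multiples A p) t}.
  move=> y py; elim: t {IHt stx lt} => // t; apply: left_series_sub.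
  exact: multiples_left_ideal.
have [z Zz Ex] := expg_approx n lt pt stx.
have [[Z0 ZB] Zst] := lt.
have -> : x *+ p ^ n = (x ^+ (p ^ n))%g + (- z) *+ p ^ n.
  by rewrite Ex -mulrnDl addrK.
rewrite addr_circ bstarMn -mulrnDl; apply: SM => [c|].
  apply: (@multiplesW A _ (p ^ n)); first exact: dvdn_exp2l.
  exact: expg_bstar.
have Nz : - z \in left_series (multiples A p) t by rewrite -sub0r; exact: ZB.
exact: IHt (ZB _ _ (Zst _ _ Nz) Zz).
Qed.

End Property1.

(** * The quotient brace and direct sums of cyclic groups *)

Section FirstIsomorphism.
Variables (A : leftBraceType) (I : {pred A}) (hI : is_brace_ideal I).
Variables (W : zmodType) (h : {additive A -> W}).
Hypotheses (ker_h : forall x, h x = 0 <-> x \in I)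
  (surj_h : forall w, exists x, h x = w).

Local Notation Q := (brace_quot hI).

Let hq (u : Q) : W := h (generic_quotient.repr u).

Let hq_pi (x : A) : hq (\pi_Q x)%qT = h x.
Proof.
apply/eqP; rewrite -subr_eq0 -raddfB; apply/eqP/ker_h.
by apply/(brace_quotP hI); rewrite reprK.
Qed.

Let hq_additive : zmod_morphism hq.
Proof.
move=> u v; have [x ->] := pi_surj u; have [y ->] := pi_surj v.
rewrite !hq_pi -[RHS](raddfB h) -[RHS]hq_pi; congr (hq _).
exact: esym (raddfB (\pi_(Quotient.quot (ideal_zmod hI)))%qT x y).
Qed.

(** The additive group of the quotient by the kernel of a surjective additive
map is isomorphic to the target. *)
Lemma brace_quot_isog : zmod_isog (brace_quot hI : leftBraceType) W.
Proof.
pose hQ : {additive (brace_quot hI : leftBraceType) -> W} :=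
  HB.pack hq (GRing.isZmodMorphism.Build _ _ hq hq_additive).
exists hQ.
have surjQ w : exists u : Q, h (generic_quotient.repr u) == w.
  by have [x <-] := surj_h w; exists (\pi_Q x)%qT; apply/eqP; exact: hq_pi.
exists (fun w => xchoose (surjQ w)) => [u|w]; last exact/eqP/(xchooseP (surjQ w)).
have /eqP := xchooseP (surjQ (hq u)).
set v := xchoose _; rewrite -[RHS]/(hq u) -/(hq v) => E.
rewrite -[LHS]reprK -[RHS]reprK; apply/(brace_quotP hI)/ker_h.
by rewrite raddfB; apply/eqP; rewrite subr_eq0; apply/eqP.
Qed.

End FirstIsomorphism.

Lemma dsumMn (J : finType) (V : J -> zmodType) (x : dsum V) n j :
  (x *+ n) j = x j *+ n.
Proof. by elim: n => [|n IH]; rewrite ?mulr0n ?mulrS ?ffunE ?IH. Qed.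

Lemma val_Cyc_Mn q (x : Cyc q) n : (0 < q)%N ->
  nat_of_ord (x *+ n : Cyc q) = (nat_of_ord x * n %% q)%N.
Proof. by case: q x => // q x _; rewrite [_ *+ _]Zp_mulrn. Qed.

Lemma val_Cyc_add q (x y : Cyc q) : (0 < q)%N ->
  nat_of_ord (x + y : Cyc q) = ((nat_of_ord x + nat_of_ord y) %% q)%N.
Proof. by case: q x y => // q x y _. Qed.

(** Reduction modulo q' from C_q to C_{q'}; a morphism when q' divides q. *)
Definition Cyc_red q q' (x : Cyc q) : Cyc q' := inZp (nat_of_ord x).

Lemma val_Cyc_red q q' (x : Cyc q) : (0 < q')%N ->
  nat_of_ord (Cyc_red q' x) = (nat_of_ord x %% q')%N.
Proof. by case: q'. Qed.

Lemma Cyc_red_add q q' : (0 < q)%N -> (q' %| q)%N ->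
  {morph @Cyc_red q q' : x y / x + y}.
Proof.
move=> q0 dq x y; have q'0 : (0 < q')%N by apply: dvdn_gt0 dq.
apply: val_inj; rewrite [LHS](val_Cyc_red _ q'0) [RHS](val_Cyc_add _ _ q'0).
by rewrite !val_Cyc_red // val_Cyc_add // modn_dvdm // modnDm.
Qed.

Section DirectSumReduction.
Variables (J : finType) (q : J -> nat) (q' : nat).
Hypotheses (q0 : forall j, (0 < q j)%N) (q'0 : (0 < q')%N).
Hypothesis dq : forall j, (q' %| q j)%N.

(** Coordinatewise reduction modulo q'. *)
Definition dsum_red (x : dsum (fun j => Cyc (q j))) : dsum (fun _ : J => Cyc q') :=
  [ffun j => Cyc_red q' (x j)].

Lemma dsum_redB : zmod_morphism dsum_red.
Proof.
move=> x y.
suff D u v : dsum_red (u + v) = dsum_red u + dsum_red v.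
  by apply: (addIr (dsum_red y)); rewrite -D !subrK.
by apply/ffunP => j; rewrite !ffunE Cyc_red_add.
Qed.

Lemma dsum_red_surj y : exists x, dsum_red x = y.
Proof.
pose x : dsum (fun j => Cyc (q j)) := [ffun j => Cyc_red (q j) (y j)].
exists x; apply/ffunP => j; rewrite !ffunE; apply: val_inj.
have yq : (nat_of_ord (y j) < q')%N by rewrite -[X in (_ < X)%N]prednK.
rewrite [LHS](val_Cyc_red _ q'0) (val_Cyc_red _ (q0 j)).
by rewrite modn_dvdm // modn_small.
Qed.

Lemma dsum_red_eq0 x : dsum_red x = 0 <-> exists y, x = y *+ q'.
Proof.
split=> [x0|[y ->]].
  pose y : dsum (fun j => Cyc (q j)) := [ffun j => inZp (nat_of_ord (x j) %/ q')].
  exists y; apply/ffunP => j; rewrite dsumMn; apply: val_inj.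
  have dx : (q' %| nat_of_ord (x j))%N.
    have := congr1 (fun z => nat_of_ord (fun_of_fin z j)) x0.
    rewrite /= !ffunE => /eqP.
    by rewrite [_ == _](_ : _ = (nat_of_ord (x j) %% q' == 0)%N) // -(val_Cyc_red _ q'0).
  have xq : (nat_of_ord (x j) < q j)%N by rewrite -[X in (_ < X)%N]prednK.
  have yj : nat_of_ord (y j) = (nat_of_ord (x j) %/ q' %% q j)%N.
    by rewrite ffunE /=; congr (_ %% _)%N; apply: prednK.
  by rewrite [RHS](val_Cyc_Mn _ _ (q0 j)) yj modnMml divnK // modn_small.
apply/ffunP => j; rewrite !ffunE dsumMn; apply: val_inj.
rewrite [LHS](val_Cyc_red _ q'0) (val_Cyc_Mn _ _ (q0 j)) modn_dvdm //.
exact: modnMl.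
Qed.

End DirectSumReduction.

(** * The two halves of the theorem *)

Lemma expn_mulrn_dsum (p : nat) (J : finType) (i : J -> nat) :
  (0 < p)%N -> forall x : dsum (fun j => Cyc (p ^ i j)),
  x *+ p ^ (\sum_j i j) = 0.
Proof.
move=> p0 x; apply/ffunP=> j; rewrite dsumMn ffunE; apply: val_inj.
rewrite [LHS]val_Cyc_Mn ?expn_gt0 ?p0 // (bigD1 j) //= expnD mulnA.
by rewrite mulnAC modnMl.
Qed.

Lemma pnat_card_dsum (p : nat) (J : finType) (i : J -> nat) : prime p ->
  (p.-nat #|{dffun forall j : J, 'I_(p ^ i j).-1.+1}|)%N.
Proof.
move=> p_pr; rewrite card_dep_ffun foldrE big_map.
apply: (big_ind (fun n => p.-nat n)%N) => // [m n pm pn|j _].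
  by rewrite pnatM pm.
by rewrite card_ord prednK ?expn_gt0 ?prime_gt0 // pnatX pnat_id ?orbT.
Qed.

Lemma property1'_ideal (p : nat) (A : leftBraceType) (J : finType)
    (i : J -> nat) (k : nat) :
  prime p -> zmod_isog A (dsum (fun j => Cyc (p ^ i j))) ->
  property1' p A -> is_brace_ideal (multiples A (p ^ k)).
Proof.
move=> p_pr [f [g fK gK]] [star_m star_self].
have [kz kst] := multiples_left_ideal A (p ^ k).
split=> // x a kx; split; last exact: kst.
have [m0|m0] := posnP (p.-1 %/ 4)%N.
  (* Here p = 2 or 3, and Property 1' says that A = pA, hence A = p^k A. *)
  elim: {kz kst x kx} k (x ⋆ a) => [|k IH] y.
    by rewrite -[y]mulr1n mem_multiples.
  move: (star_m 0 y); rewrite m0 /= => /multiplesP[z ->].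
  have /multiplesP[w ->] := IH z.
  by rewrite -mulrnA -expnSr mem_multiples.
have mp : (4 * (p.-1 %/ 4) < p)%N.
  by rewrite -[X in (_ < X)%N](prednK (prime_gt0 p_pr)) ltnS mulnC leq_trunc_div.
move: kx => /multiplesP[y ->].
apply: (@multiples_bstar _ _ _ p_pr m0 mp star_m (star_self m0) _ _ _ _ (\sum_j i j)%N) => //.
  move=> z; apply: (can_inj fK); rewrite raddfMn raddf0.
  exact: expn_mulrn_dsum (prime_gt0 p_pr) _.
exact: (left_series_full (F := {dffun forall j : J, 'I_(p ^ i j).-1.+1})
  p_pr fK gK (pnat_card_dsum _ p_pr) (multiples_left_ideal A p)).
Qed.

Lemma multiples_quot_isog (p : nat) (A : leftBraceType) (J : finType)
    (i : J -> nat) (k : nat) (hI : is_brace_ideal (multiples A (p ^ k))) :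
  (0 < p)%N -> zmod_isog A (dsum (fun j => Cyc (p ^ i j))) ->
  (forall j, (k <= i j)%N) ->
  zmod_isog (brace_quot hI : leftBraceType) (dsum (fun _ : J => Cyc (p ^ k))).
Proof.
move=> p0 [f [g fK gK]] le_k.
have q0 j : (0 < p ^ j)%N by rewrite expn_gt0 p0.
have dq j : (p ^ k %| p ^ i j)%N by apply: dvdn_exp2l.
pose h0 x := dsum_red (p ^ k) (f x).
have h0B : zmod_morphism h0.
  by move=> x y; rewrite /h0 raddfB (dsum_redB (fun j => q0 (i j)) dq).
pose h : {additive A -> _} := HB.pack h0 (GRing.isZmodMorphism.Build _ _ h0 h0B).
apply: (brace_quot_isog hI (h := h)) => [x|w].
  split=> [/(dsum_red_eq0 (fun j => q0 (i j)) (q0 k) dq)[y Ey]|/multiplesP[y ->]].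
    by apply/multiplesP; exists (g y); apply: (can_inj fK); rewrite raddfMn gK.
  apply/(dsum_red_eq0 (fun j => q0 (i j)) (q0 k) dq).
  by exists (f y); rewrite raddfMn.
have [y <-] := dsum_red_surj (fun j => q0 (i j)) (q0 k) dq w.
by exists (g y); rewrite /= /h0 gK.
Qed.

Local Close Scope brace_scope.
Local Close Scope ring_scope.

Theorem lemma3 (p : nat) (A : leftBraceType) (beta : nat)
    (i : 'I_beta -> nat) (alpha : nat) (p_prime : prime p)
    (isoA : zmod_isog A (dsum (fun j : 'I_beta => Cyc (p ^ i j))))
    (le_alpha : forall j : 'I_beta, alpha <= i j) :
  (2 < p -> property1' p A -> is_brace_ideal (multiples A (p ^ alpha))) /\
  (forall idealI : is_brace_ideal (multiples A (p ^ alpha)),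
     zmod_isog (brace_quot idealI : leftBraceType)
       (dsum (fun _ : 'I_beta => Cyc (p ^ alpha)))
     /\ uniform p (brace_quot idealI : leftBraceType)).
Proof.
split=> [_|hI]; first exact: property1'_ideal isoA.
have iso := multiples_quot_isog hI (prime_gt0 p_prime) isoA le_alpha.
by split=> //; exists alpha, beta.
Qed.
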